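(* Let $a,b$ be integers with $0\le a<b$. For $n\ge1$ let $\chi^{ab}_n(q)$ be the characteristic polynomial of the arrangement $\mathcal{A}^{ab}_{n-1}$ in $V_{n-1}=\{x\in\mathbb{R}^n:\sum x_i=0\}$ given by $x_i-x_j=-a+1,-a+2,\dots,b-1$, $1\le i<j\le n$. Let $S$ be the shift operator on polynomials, $(Sg)(q)=g(q-1)$. Then $$\chi^{ab}_n(q)=(b-a)^{-n}\,\big(S^a+S^{a+1}+\cdots+S^{b-1}\big)^n\, q^{n-1}.$$
   Context: For an arrangement $\mathcal{A}$ in a real vector space $V$, the intersection poset $L_{\mathcal{A}}$ is the set of nonempty intersections of subsets of hyperplanes of $\mathcal{A}$ (including $V$ itself, the minimum $\hat0$), ordered by reverse inclusion, and the characteristic polynomial is $\chi_{\mathcal{A}}(q)=\sum_{z\in L_{\mathcal{A}}}\mu(\hat0,z)\,q^{\dim z}$, where $\mu$ is the Möbius function of $L_{\mathcal{A}}$. Here $\dim V_{n-1}=n-1$. *)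

(* Defs.v *)
From mathcomp Require Import all_boot all_order all_algebra.
From mathcomp Require Import finmap zify.
From mathcomp Require Import boolp classical_sets functions cardinality reals.

Set Implicit Arguments.
Unset Strict Implicit.
Unset Printing Implicit Defensive.

Import Order.TTheory GRing.Theory Num.Theory.
Local Open Scope classical_set_scope.
Local Open Scope ring_scope.

Section Mobius.
Variables (T : choiceType) (P : {fset T}) (le : rel T).

(* [#|` P|] bounds the length of every chain of P, so this fuel is never
   exhausted: see [mobius_lt]. *)
Fixpoint mobius_rec (fuel : nat) (x y : T) : int :=
  if fuel is fuel'.+1 then
    if x == y then 1
    else if le x y then
      - \sum_(z <- P | [&& le x z, le z y & z != y]) mobius_rec fuel' x z
    else 0
  else 0.

Definition mobius (x y : T) : int := mobius_rec #|` P| x y.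

End Mobius.

Section MobiusTheory.
Variables (T : choiceType) (P : {fset T}) (le : rel T).
Hypotheses (le_refl : reflexive le) (le_anti : antisymmetric le).
Hypothesis le_trans : transitive le.

Let below y := [fset z in P | le z y]%fset.

Let below_lt z y : y \in P -> le z y -> z != y ->
  (#|` below z| < #|` below y|)%N.
Proof.
move=> yP zy nzy; apply: fproper_ltn_card; apply/andP; split.
  apply/fsubsetP => t; rewrite !inE /= => /andP[-> tz] /=.
  exact: le_trans tz zy.
apply: contra nzy => /fsubsetP/(_ y); rewrite !inE /= yP le_refl => /(_ isT) yz.
by apply/eqP/le_anti; rewrite zy.
Qed.

Let mobius_fuel m n x y : y \in P -> (#|` below y| <= m)%N ->
  (#|` below y| <= n)%N -> mobius_rec P le m x y = mobius_rec P le n x y.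
Proof.
have gt0 z : z \in P -> (0 < #|` below z|)%N.
  by move=> zP; rewrite cardfs_gt0; apply/fset0Pn; exists z; rewrite !inE zP le_refl.
elim: m n y => [|m IH] [|n] y yP; rewrite ?leqn0 ?(gtn_eqF (gt0 _ yP)) //.
move=> hm hn /=; case: ifP => // _; case: ifP => // _; congr (- _).
rewrite big_seq_cond [RHS]big_seq_cond.
apply: eq_bigr => z /andP[zP /and3P[_ zy nzy]]; have lt := below_lt yP zy nzy.
by apply: IH => //; rewrite -ltnS; [exact: leq_trans hm|exact: leq_trans hn].
Qed.

Lemma mobius_diag x : x \in P -> mobius P le x x = 1.
Proof.
move=> xP; rewrite /mobius.
have: (0 < #|` P|)%N by rewrite cardfs_gt0; apply/fset0Pn; exists x.
by case: #|` P| => //= k _; rewrite eqxx.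
Qed.

Lemma mobius_lt x y : y \in P -> le x y -> x != y ->
  mobius P le x y = - \sum_(z <- P | [&& le x z, le z y & z != y]) mobius P le x z.
Proof.
move=> yP xy nxy; rewrite /mobius.
have bP z : (#|` below z| <= #|` P|)%N.
  by apply: fsubset_leq_card; exact: fset_sub.
rewrite (@mobius_fuel _ #|` P|.+1) //=; last exact: leqW.
by rewrite (negPf nxy) xy.
Qed.

End MobiusTheory.

Section Arrangement.
Variables (R : realType) (V : vectType R).
Implicit Types (A : set (set V)) (z : set V).

(* The empty subfamily contributes [setT], i.e. the whole space V. *)
Definition flats A : set (set V) :=
  [set z | z !=set0 /\ exists2 B, B `<=` A & z = \bigcap_(H in B) H].

Definition flat_le : rel (set V) := fun z w => `[< w `<=` z >].

(* The dimension of the linear subspace U such that z = p + U;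
   it is a junk value when z is not a nonempty affine subspace. *)
Definition affine_dim z : nat :=
  \dim (xget 0%VS [set U : {vspace V} |
                    exists p : V, z = [set x | x - p \in U]]).

(* Only meaningful for a finite family A (see [finite_flats]):
   [fset_set] is empty on infinite sets. *)
Definition arr_charpoly A : {poly rat} :=
  \sum_(z <- fset_set (flats A))
     (mobius (fset_set (flats A)) flat_le setT z)%:~R *: 'X^(affine_dim z).

Lemma finite_flats A : finite_set A -> finite_set (flats A).
Proof.
move=> finA; pose F (B : {fset (set V)}) := \bigcap_(H in [set` B]) H.
apply: (@sub_finite_set _ _ (F @` [set` fpowerset (fset_set A)])).
  move=> z [_ [B BA ->]]; have finB := sub_finite_set BA finA.
  exists (fset_set B); last by rewrite /F fset_setK.
  rewrite /= fpowersetE; apply/fsubsetP => H.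
  by rewrite !in_fset_set // !inE; exact: BA.
exact/finite_image/finite_fset.
Qed.

Lemma affine_dimE (p : V) (U : {vspace V}) :
  affine_dim [set x | x - p \in U] = \dim U.
Proof.
rewrite /affine_dim; congr (\dim _); apply: xget_unique; first by exists p.
move=> W [q eqW].
have pW : p - q \in W.
  have : [set x | x - p \in U] p by rewrite /= subrr mem0v.
  by rewrite eqW.
apply/vspaceP => v.
have /= := congr1 (fun S : set V => S (v + p)) eqW.
rewrite addrK => /propeqP e; apply/idP/idP => [vW|vU].
  by apply/e; rewrite -addrA memvD.
by have := memvB ((iffLR e) vU) pW; rewrite opprB addrA subrK addrK.
Qed.

End Arrangement.

Section TruncatedAffine.
Variables (R : realType) (n : nat).

Definition sum_zero : {vspace 'rV[R]_n} :=
  lker (linfun (mulmxr (const_mx 1 : 'cV[R]_n) : 'rV[R]_n -> 'rV[R]_1)).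

Lemma mem_sum_zero (x : 'rV[R]_n) :
  (x \in sum_zero) = (\sum_i x ord0 i == 0).
Proof.
have e : (x *m const_mx 1 : 'rV[R]_1) = (\sum_i x ord0 i)%:M.
  apply/matrixP => i j; rewrite !mxE !ord1 eqxx mulr1n.
  by apply: eq_bigr => k _; rewrite mxE mulr1.
rewrite memv_ker lfunE /= e; apply/eqP/eqP => [/matrixP/(_ ord0 ord0)|->].
  by rewrite !mxE eqxx mulr1n.
by rewrite raddf0.
Qed.

Definition pcoord (x : subvs_of sum_zero) (i : 'I_n) : R :=
  (vsval x : 'rV[R]_n) ord0 i.

Definition trunc_arr (a b : nat) : set (set (subvs_of sum_zero)) :=
  [set H | exists (i j : 'I_n) (k : int),
     [/\ (i < j)%N, - a%:Z + 1 <= k <= b%:Z - 1 &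
         H = [set x | pcoord x i - pcoord x j = k%:~R]]].

Lemma finite_trunc_arr (a b : nat) : finite_set (trunc_arr a b).
Proof.
pose F (p : 'I_n * 'I_n * 'I_(a + b)) : set (subvs_of sum_zero) :=
  [set x | pcoord x p.1.1 - pcoord x p.1.2 = (p.2%:Z - a%:Z + 1)%:~R].
apply: (@sub_finite_set _ _ (F @` setT)); last exact/finite_image/finite_finset.
move=> H [i [j [k [_ /andP[ak kb] ->]]]].
have [m km] : exists m : nat, k + a%:Z - 1 = m%:Z.
  have : 0 <= k + a%:Z - 1 by lia.
  by case: (k + a%:Z - 1) => // m _; exists m.
have kE : k = m%:Z - a%:Z + 1 by lia.
have mab : (m < a + b)%N by lia.
by exists (i, j, Ordinal mab) => //=; rewrite /F /= -kE.
Qed.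

End TruncatedAffine.

Definition shift_poly (g : {poly rat}) : {poly rat} := g \Po ('X - 1).

Definition shift_sum (a b : nat) (g : {poly rat}) : {poly rat} :=
  \sum_(a <= k < b) iter k shift_poly g.

(* Main.v *)
(* The finite field method, applied modulo an arbitrary large integer q: for a
   point p, the Moebius values of the flats through p add up to 1 if p lies on no
   hyperplane and to 0 otherwise, and a flat of dimension d contains q^d residue
   vectors modulo q with last coordinate 0.  Hence chi(q) counts the placements
   of n labels on a circle of length q, one of them fixed, in which the gap from
   a label to the next one is at least a at an ascent and at least b at a descent.
   Let m = b - a.  Writing each gap as a + m h + j with 0 <= j < m, the numbers h
   are the gaps of a placement for the parameters (0, 1), and these are arbitrary
   maps.  So chi(q) is the sum of ((q - k_1 - ... - k_n) / m)^(n-1) over all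
   a <= k_i < b such that m divides q - k_1 - ... - k_n.  Finally the indicator
   of divisibility by m can be replaced with its mean 1/m: their difference
   has vanishing sums over windows of length m, and each of the n window sums
   lowers the degree of its polynomial coefficient. *)
From HB Require Import structures.
Require Import Defs.
From mathcomp Require Import all_boot all_order all_algebra.
From mathcomp Require Import finmap zify ring lra.
From mathcomp Require Import boolp classical_sets functions cardinality reals.

Set Implicit Arguments.
Unset Strict Implicit.
Unset Printing Implicit Defensive.

Import Order.TTheory GRing.Theory Num.Theory.
Local Open Scope ring_scope.

(** * Placements with prescribed gaps *)

Section Placements.
Variables (n a b : nat).
Hypothesis ab : (a < b)%N.
Implicit Types (A : {set 'I_n}) (l i j : 'I_n).

Definition gap l i : nat := if (l < i)%N then a else b.

(* [e i] is the distance from the position of the label i to the end of a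
   segment of length u, which starts at the label l. *)
Definition placement B A l u : pred {ffun 'I_n -> 'I_B.+1} :=
  [pred e : {ffun 'I_n -> 'I_B.+1} |
    [&& [forall i, (i \notin A) ==> (e i == ord0)], (a <= u)%N,
        [forall (i | i \in A), (a <= e i) && (e i + gap l i <= u)] &
        [forall (i | i \in A), forall (j | j \in A),
           (i < j) ==> ((e i + b <= e j) || (e j + a <= e i))]]]%N.

Arguments placement B A l u : clear implicits.

Lemma placementP B A l u (e : {ffun 'I_n -> 'I_B.+1}) :
  reflect [/\ forall i, i \notin A -> e i = ord0, (a <= u)%N,
              forall i, i \in A -> (a <= e i)%N /\ (e i + gap l i <= u)%N &
              forall i j, i \in A -> j \in A -> (i < j)%N ->
                (e i + b <= e j)%N \/ (e j + a <= e i)%N]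
          (placement B A l u e).
Proof.
apply: (iffP and4P) => [[h1 h2 h3 h4]|[h1 h2 h3 h4]]; split=> //.
- by move=> i iA; apply/eqP; move/forallP: h1 => /(_ i); rewrite iA.
- by move=> i iA; apply/andP; move/forall_inP: h3; exact.
- move=> i j iA jA ij; apply/orP.
  by move/forall_inP: h4 => /(_ i iA)/forall_inP/(_ j jA)/implyP; exact.
- by apply/forallP => i; apply/implyP => /h1 ->.
- by apply/forall_inP => i /h3[-> ->].
- apply/forall_inP => i iA; apply/forall_inP => j jA; apply/implyP => ij.
  by apply/orP; exact: h4.
Qed.

(** A larger [e] means an earlier position. When [a = 0] labels may share a position, and they are
    then read in increasing order. *)
Definition precedes B (e : {ffun 'I_n -> 'I_B.+1}) i j : bool :=
  (e j < e i)%N || (e j == e i :> nat) && (i < j)%N.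

Definition is_first B (e : {ffun 'I_n -> 'I_B.+1}) A i : bool :=
  (i \in A) && [forall (j | j \in A), (j == i) || precedes e i j].

(** Existence and uniqueness are stated as a sum so that it can be inserted into a count: the first
    label maximizes [e], with ties broken by the least label. *)
Lemma sum_is_first B (e : {ffun 'I_n -> 'I_B.+1}) A : A != finset.set0 ->
  (\sum_(i in A) is_first e A i = 1)%N.
Proof.
case/set0Pn => i0 i0A.
pose i1 := [arg max_(i > i0 in A) e i].
have [i1A max1] : i1 \in A /\ forall j, j \in A -> (e j <= e i1)%N.
  by rewrite /i1; case: arg_maxnP => // i iA h; split.
have pP : (i1 \in A) && (e i1 == e i1) by rewrite i1A eqxx.
pose i2 := [arg min_(i < i1 | (i \in A) && (e i == e i1)) i].
have [i2A e2 min2] : [/\ i2 \in A, e i2 = e i1 &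
    forall j, j \in A -> e j = e i1 -> (i2 <= j)%N].
  rewrite /i2; case: arg_minnP => // i /andP[iA /eqP ei] h; split=> // j jA ej.
  by apply: h; rewrite jA ej eqxx.
have f2 : is_first e A i2.
  rewrite /is_first i2A /=; apply/forall_inP => j jA; rewrite /precedes e2.
  have := max1 j jA; rewrite leq_eqVlt => /orP[/eqP ej|->]; last by rewrite orbT.
  have := min2 j jA (val_inj ej); rewrite leq_eqVlt => /orP[/eqP ij|->].
    by apply/orP; left; apply/eqP/val_inj.
  by rewrite ej eqxx !orbT.
rewrite (bigD1 i2) //= f2 big1 // => i /andP[iA i2i].
apply/eqP; rewrite eqb0; apply/negP => /andP[_ /forall_inP/(_ _ i2A)].
have /andP[_ /forall_inP/(_ _ iA)] := f2.
rewrite (negPf i2i) eq_sym (negPf i2i) /= /precedes.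
lia.
Qed.

(** Removing the first label [i], at distance [t] from the end, leaves a placement of the other
    labels in the segment of length [t] that starts at [i]. *)
Lemma card_placement_rec B A l u : A != finset.set0 ->
  #|placement B A l u| =
  (\sum_(i in A) \sum_(t < B.+1 | (t + gap l i <= u)%N)
     #|placement B (A :\ i) i t|)%N.
Proof.
move=> A0; rewrite -sum1_card.
under eq_bigr => e _ do rewrite -(sum_is_first e A0).
rewrite exchange_big /=; apply: eq_bigr => i iA.
rewrite -big_mkcondr /= (partition_big (fun e : {ffun 'I_n -> 'I_B.+1} => e i) predT) //=.
rewrite [RHS]big_mkcond /=; apply: eq_bigr => t _.
pose upd (t : 'I_B.+1) (e : {ffun 'I_n -> 'I_B.+1}) : {ffun 'I_n -> 'I_B.+1} :=
  [ffun j => if j == i then t else e j].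
have key (e : {ffun 'I_n -> 'I_B.+1}) : e i = t ->
    (placement B A l u e && is_first e A i) =
    (t + gap l i <= u)%N && placement B (A :\ i) i t (upd ord0 e).
  move=> eit; apply/andP/andP.
    case=> /placementP[h1 h2 h3 h4] /andP[_ /forall_inP h5].
    have [ai iu] := h3 i iA; rewrite eit in ai iu; split => //.
    apply/placementP; split => //.
    - move=> j; rewrite !inE ffunE negb_and negbK.
      by case: eqP => //= _; exact: h1.
    - move=> j; rewrite !inE ffunE => /andP[ji jA]; rewrite (negPf ji).
      have [aj ju] := h3 j jA; split=> //.
      have := h5 j jA; rewrite (negPf ji) /= /precedes eit /gap.
      case: (ltngtP i j) => ij.
      + by have := h4 i j iA jA ij; rewrite eit; lia.
      + by have := h4 j i jA iA ij; rewrite eit; lia.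
      + by move: ji; rewrite (val_inj ij) eqxx.
    - move=> j k; rewrite !inE !ffunE => /andP[/negPf -> jA] /andP[/negPf -> kA].
      exact: h4.
  case=> iu /placementP[h1 h2 h3 h4].
  have {}h3 j : j \in A -> j != i -> (a <= e j)%N /\ (e j + gap i j <= t)%N.
    by move=> jA ji; have := h3 j; rewrite !inE jA ji ffunE (negPf ji); exact.
  split; last first.
    rewrite /is_first iA; apply/forall_inP => j jA.
    have [//|ji /=] := eqVneq j i.
    have [_] := h3 j jA ji; rewrite /precedes eit /gap.
    case: (ltngtP i j) => ij; [lia|lia|].
    by move: ji; rewrite (val_inj ij) eqxx.
  have pair i' j : i' \in A -> j \in A -> i' != i -> j != i -> (i' < j)%N ->
      (e i' + b <= e j)%N \/ (e j + a <= e i')%N.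
    move=> iA' jA ii ji ij; have := h4 i' j.
    by rewrite !inE ii ji iA' jA !ffunE (negPf ii) (negPf ji); exact.
  apply/placementP; split.
  - move=> j jA; have := h1 j; rewrite !inE negb_and jA orbT ffunE.
    have [ji|_] := eqVneq j i; first by rewrite ji iA in jA.
    exact.
  - lia.
  - move=> j jA; have [->|ji] := eqVneq j i; first by rewrite eit.
    (* Here [gap l j <= gap l i + gap i j]: if [l < j] fails, then [l < i] or [i < j] fails too, and
       that gap is already [b]. *)
    have [aj jt] := h3 j jA ji; split=> //; move: iu jt.
    by rewrite /gap; case: (ltnP l j); case: (ltnP l i); case: (ltnP i j); lia.
  - move=> j k jA kA jk.
    have [ji|ji] := eqVneq j i; have [ki|ki] := eqVneq k i; last exact: pair.
    + by move: jk; rewrite ji ki ltnn.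
    + rewrite ji in jk *; have [_] := h3 k kA ki.
      by rewrite /gap jk eit; right.
    + rewrite ki in jk *; have [_] := h3 j jA ji.
      by rewrite eit /gap (ltnNge i) (ltnW jk) /=; left.
case: ifP => tu; last first.
  by rewrite big_pred0 // => e; apply/negP => /andP[+ /eqP/key ke]; rewrite ke tu.
rewrite sum1_card -(card_in_imset (f := upd ord0)); last first.
  move=> e f /andP[_ /eqP ei] /andP[_ /eqP fi] /ffunP ef; apply/ffunP => j.
  have := ef j; rewrite !ffunE; case: eqP => // -> _; by rewrite ei fi.
apply: eq_card => e; apply/imsetP/idP => [[f /andP[+ /eqP fi] ->]|pe].
  by rewrite key // tu.
exists (upd t e); last first.
  apply/ffunP => j; rewrite !ffunE; case: eqP => // ->.
  have /placementP[h1 _ _ _] := pe.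
  by apply: h1; rewrite !inE eqxx.
have ei : upd t e i = t by rewrite ffunE eqxx.
rewrite unfold_in ei eqxx andbT key // tu /=.
have -> // : upd ord0 (upd t e) = e.
apply/ffunP => j; rewrite !ffunE; case: eqP => // ->.
have /placementP[h1 _ _ _] := pe.
by rewrite h1 // !inE eqxx.
Qed.

(** [k] stands for the number of labels in [A] and makes the recursion structural. The truncated
    subtraction empties the range of [t] when [u < gap l i]. *)
Fixpoint placements k A l (u : nat) : nat :=
  if k is k'.+1 then
    \sum_(i in A) \sum_(t < u.+1 - gap l i) placements k' (A :\ i) i t
  else (a <= u)%N.

Lemma card_placement B A l u :
  (forall i, i \in A -> (u < B.+1 + gap l i)%N) ->
  #|placement B A l u| = placements #|A| A l u.
Proof.
have [k] := ubnP #|A|; elim: k A l u => // k IH A l u Ak uB.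
have [A0|A0] := eqVneq A finset.set0.
  rewrite A0 cards0 /=.
  have pE : placement B finset.set0 l u =i [pred e | (a <= u)%N && (e == [ffun=> ord0])].
    move=> e; apply/placementP/andP => [[h1 h2 _ _]|[h1 /eqP ->]].
      by split=> //; apply/eqP/ffunP => i; rewrite ffunE h1 // inE.
    by split=> // i; rewrite ?ffunE // inE.
  rewrite (eq_card pE); case: (a <= u)%N => /=; first by rewrite card1.
  by rewrite card0.
rewrite card_placement_rec //; case cA : #|A| => [|k'].
  by move/eqP: cA; rewrite cards_eq0 (negPf A0).
rewrite /=; apply: eq_bigr => i iA.
have le : (u.+1 - gap l i <= B.+1)%N by have := uB i iA; lia.
rewrite (big_ord_widen _ (fun t => placements k' (A :\ i) i t) le).
apply: eq_big => [t|t tu]; first by lia.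
have cAi : #|A :\ i| = k' by move: cA; rewrite (cardsD1 i) iA => -[].
rewrite IH ?cAi //; first by rewrite cA in Ak.
by move=> j _; rewrite (leq_trans (ltn_ord t)) // leq_addr.
Qed.

End Placements.

(** For the parameters (0, 1) the condition on pairs holds for any two integers, and the descent
    from [l] only demands [e i < r]. *)
Lemma placements01 n (A : {set 'I_n}) (l : 'I_n) r : (forall i, i \in A -> (i < l)%N) ->
  placements 0 1 #|A| A l r = (r ^ #|A|)%N.
Proof.
move=> Al; rewrite -(@card_placement _ 0 1 _ r) //; last by move=> i _; rewrite leq_addr.
have cr : #|[pred t : 'I_r.+1 | (t < r)%N]| = r.
  rewrite -sum1_card (eq_bigl (fun t : 'I_r.+1 => (t < r)%N)) //.
  by rewrite -(big_ord_widen _ (fun _ => 1%N) (leqnSn r)) sum1_card card_ord.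
rewrite -[r in RHS]cr -(card_pffun_on ord0); apply: eq_card => e.
apply/placementP/(pffun_onP (y := ord0)) => [[h1 _ h3 _]|[/supportP h1 h2]].
  split; first by apply/supportP.
  move=> _ /fintype.imageP[i iA ->]; rewrite inE.
  by have [_] := h3 i iA; rewrite /gap (ltnNge l) (ltnW (Al i iA)) // addn1.
split=> // [i iA|i j _ _ _]; last by lia.
rewrite /gap (ltnNge l) (ltnW (Al i iA)) //= addn1; split=> //.
exact: (h2 _ (fintype.image_f _ iA)).
Qed.

(** * Window sums *)

Section Windows.
Implicit Types (F : int -> rat) (u v : int) (k : nat).

(** On generating functions, [nabla] multiplies by 1 - x, [window] multiplies by x^a + ... +
    x^(b-1), and [dilate] substitutes x^m for x. *)
Definition nat_ext (f : nat -> nat) u : rat := if u is Posz v then (f v)%:R else 0.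

Definition nabla F u : rat := F u - F (u - 1).

Definition window a b F u : rat := \sum_(a <= k < b) F (u - k%:Z).

Lemma windowE a b F u : window a b F u = \sum_(a <= k < b) F (u - k%:Z).
Proof. by []. Qed.

Definition dilate m F u : rat := if (m%:Z %| u)%Z then F (u %/ m)%Z else 0.

Lemma causal_eq F F' : (forall u, u < 0 -> F u = 0) ->
  (forall u, u < 0 -> F' u = 0) -> nabla F =1 nabla F' -> F =1 F'.
Proof.
move=> F0 F'0 eF [v|v]; last by rewrite F0 ?F'0.
elim: v => [|v IH]; first by have := eF 0; rewrite /nabla (F0 (0 - 1)) ?(F'0 (0 - 1)) ?subr0.
have := eF v.+1%:Z; rewrite /nabla.
have -> : v.+1%:Z - 1 = v by lia.
by rewrite IH => /addIr.
Qed.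

Lemma iter_window_sum a b k (I : Type) (r : seq I) (P : pred I)
    (F : I -> int -> rat) u :
  iter k (window a b) (fun v => \sum_(i <- r | P i) F i v) u =
  \sum_(i <- r | P i) iter k (window a b) (F i) u.
Proof.
elim: k u => //= k IH u; rewrite windowE.
by rewrite (eq_bigr _ (fun (j : nat) _ => IH (u - j%:Z))) exchange_big.
Qed.

Lemma iter_windowZ a b k x F u :
  iter k (window a b) (fun v => x * F v) u = x * iter k (window a b) F u.
Proof.
elim: k u => //= k IH u; rewrite !windowE mulr_sumr.
by apply: eq_bigr => j _; rewrite IH.
Qed.

Lemma iter_windowB a b k F F' u :
  iter k (window a b) (fun v => F v - F' v) u =
  iter k (window a b) F u - iter k (window a b) F' u.
Proof.
elim: k u => //= k IH u; rewrite windowE.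
by rewrite (eq_bigr _ (fun (j : nat) _ => IH (u - j%:Z))) sumrB.
Qed.

Lemma iter_window_shift a b k F c u :
  iter k (window a b) (fun v => F (v - c)) u = iter k (window a b) F (u - c).
Proof.
elim: k u => //= k IH u; rewrite !windowE; apply: eq_bigr => j _.
by rewrite IH addrAC.
Qed.

Lemma nabla_iter_window a b k F :
  nabla (iter k (window a b) F) =1 iter k (window a b) (nabla F).
Proof. by move=> u; rewrite /nabla iter_windowB iter_window_shift. Qed.

Lemma window_nabla a b F u : (a <= b)%N ->
  window a b (nabla F) u = F (u - a%:Z) - F (u - b%:Z).
Proof.
move=> ab; rewrite -opprB -(telescope_sumr (fun k => F (u - k%:Z)) ab) -sumrN.
apply: eq_bigr => k _; rewrite /nabla opprB; congr (_ - F _); lia.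
Qed.

Lemma iter_window_causal a b k F : (forall u, u < 0 -> F u = 0) ->
  forall u, u < 0 -> iter k (window a b) F u = 0.
Proof.
move=> F0; elim: k => //= k IH u u0; rewrite windowE big1 // => j _.
by apply: IH; lia.
Qed.

Lemma eq_iter_window a b k F F' : F =1 F' ->
  iter k (window a b) F =1 iter k (window a b) F'.
Proof. by move=> /funext ->. Qed.

(** One window looks back by less than [b], so [k] windows starting from [u >= k * b] never reach a
    negative argument. *)
Lemma eq_iter_window_ge0 a b k F F' : (forall u, 0 <= u -> F u = F' u) ->
  forall u, (k * b)%:Z <= u ->
  iter k (window a b) F u = iter k (window a b) F' u.
Proof.
move=> eF; elim: k => [|k IH] u uk /=; first exact: eF.
rewrite !windowE big_nat [RHS]big_nat; apply: eq_bigr => j /andP[_ jb].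
apply: IH; move: uk; rewrite mulSn PoszD; lia.
Qed.

Lemma dilate_causal m F : (0 < m)%N -> (forall u, u < 0 -> F u = 0) ->
  forall u, u < 0 -> dilate m F u = 0.
Proof.
move=> m0 F0 u u0; rewrite /dilate; case: ifP => // /dvdzP[t tE].
by rewrite F0 // tE mulzK ?gtn_eqF //; nia.
Qed.

Lemma dilate_mulB m F u v : (0 < m)%N ->
  dilate m F (u - m%:Z * v) = dilate m (fun t => F (t - v)) u.
Proof.
move=> m0; rewrite /dilate mulrC -[in LHS](subrK 0 (u - _)).
have -> : (m%:Z %| u - v * m%:Z - 0 + 0)%Z = (m%:Z %| u)%Z.
  rewrite subrK -mulNr; apply/idP/idP => [h|h].
    by have := rpredB h (dvdz_mull (- v) (dvdzz m%:Z)); rewrite addrK.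
  by rewrite rpredD // dvdz_mull.
case: ifP => // um; rewrite subrK -mulNr divzDl //.
by rewrite mulzK //; lia.
Qed.

(** Dilation turns 1 - x into 1 - x^m, and x^a (1 - x^m) is what [window_nabla] leaves of a window
    of length [m]. *)
Lemma nabla_dilate m a F u : (0 < m)%N ->
  dilate m F (u - a%:Z) - dilate m F (u - (a + m)%:Z) =
  dilate m (nabla F) (u - a%:Z).
Proof.
move=> m0; have -> : u - (a + m)%:Z = u - a%:Z - m%:Z * 1 by lia.
by rewrite dilate_mulB // /dilate; case: ifP => //; rewrite subr0.
Qed.

Lemma nat_ext_lt0 f u : u < 0 -> nat_ext f u = 0.
Proof. by case: u. Qed.

End Windows.

(** * Placement counts as iterated window sums *)

Section GapDecomposition.
Variables (n a m : nat).
Hypothesis m0 : (0 < m)%N.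

Lemma nabla_placements0 a' b' (A : {set 'I_n}) (l : 'I_n) u :
  nabla (nat_ext (placements a' b' 0 A l)) u = (u == a')%:R.
Proof.
have -> : nabla (nat_ext (placements a' b' 0 A l)) u =
    (a'%:Z <= u)%R%:R - (a'%:Z <= u - 1)%R%:R.
  have extE v : nat_ext (placements a' b' 0 A l) v = (a'%:Z <= v)%R%:R by case: v.
  by rewrite /nabla !extE.
have -> : (a'%:Z <= u - 1) = (a'%:Z <= u) && (u != a') by lia.
by case: eqP => [->|_]; rewrite ?andbT ?subrr // lexx subr0.
Qed.

(** Differencing in [u] keeps only the top term [t = u - gap] of each inner sum; when [u] is below
    the gap, [nat_ext] supplies the value 0. *)
Lemma nabla_placementsS a' b' k (A : {set 'I_n}) (l : 'I_n) u :
  nabla (nat_ext (placements a' b' k.+1 A l)) u =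
  \sum_(i in A) nat_ext (placements a' b' k (A :\ i) i) (u - (gap a' b' l i)%:Z).
Proof.
have lt0 (v : nat) (g : nat) : (v < g)%N -> v%:Z - g%:Z < 0 by lia.
rewrite /nabla; case: u => [v|u]; last first.
  have -> : Negz u - 1 = Negz u.+1 by lia.
  rewrite subrr big1 // => i _; rewrite nat_ext_lt0 //; lia.
have -> : nat_ext (placements a' b' k.+1 A l) (v%:Z - 1) =
    \sum_(i in A) \sum_(t < v - gap a' b' l i) (placements a' b' k (A :\ i) i t)%:R.
  case: v => [|v]; first by rewrite big1 // => i _; rewrite big_ord0.
  have -> : v.+1%:Z - 1 = v by lia.
  by rewrite /= natr_sum; apply: eq_bigr => i _; rewrite natr_sum.
rewrite /= natr_sum -sumrB; apply: eq_bigr => i _; rewrite natr_sum.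
case: (ltnP v (gap a' b' l i)) => vg.
  have -> : (v.+1 - gap a' b' l i = 0)%N by lia.
  have -> : (v - gap a' b' l i = 0)%N by lia.
  by rewrite !big_ord0 subrr nat_ext_lt0 // lt0.
have -> : (v.+1 - gap a' b' l i = (v - gap a' b' l i).+1)%N by lia.
rewrite big_ord_recr /= addrC addrK.
by have -> : v%:Z - (gap a' b' l i)%:Z = (v - gap a' b' l i)%N by lia.
Qed.

(* Every gap is a + m h + j with 0 <= j < m, where h is an admissible gap for
   the parameters (0, 1); [window] sums over j. *)
Lemma placements_dilate k (A : {set 'I_n}) (l : 'I_n) :
  nat_ext (placements a (a + m) k A l) =1
  iter k.+1 (window a (a + m)) (dilate m (nat_ext (placements 0 1 k A l))).
Proof.
have causal k' (A' : {set 'I_n}) l' u : u < 0 ->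
    dilate m (nat_ext (placements 0 1 k' A' l')) u = 0.
  by apply: dilate_causal => // v; exact: nat_ext_lt0.
(* Both sides vanish at negative arguments, so it suffices to compare differences. On the right the
   difference consumes one window. *)
elim: k A l => [|k IH] A l; apply: causal_eq => [u|u|u].
- exact: nat_ext_lt0.
- by apply: iter_window_causal; exact: causal.
- rewrite nabla_iter_window -[iter 1 _ _]/(window a (a + m) _).
  rewrite window_nabla ?leq_addr // nabla_dilate //.
  rewrite nabla_placements0 /dilate nabla_placements0.
  rewrite -subr_eq0; have [->|ua] := eqVneq (u - a%:Z) 0; first by rewrite dvdz0 div0z.
  case: ifP => // /dvdzP[t tE]; rewrite tE mulzK; last by lia.
  by case: eqP => // t0; move: ua; rewrite tE t0 mul0r eqxx.
- exact: nat_ext_lt0.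
- by apply: iter_window_causal; exact: causal.
rewrite nabla_placementsS nabla_iter_window iterSr.
pose F i := dilate m (nat_ext (placements 0 1 k (A :\ i) i)).
pose c i := (gap a (a + m) l i)%:Z.
have -> : iter k.+1 (window a (a + m))
      (window a (a + m) (nabla (dilate m (nat_ext (placements 0 1 k.+1 A l))))) u =
    iter k.+1 (window a (a + m)) (fun v => \sum_(i in A) F i (v - c i)) u.
  apply: eq_iter_window.
  move=> v; rewrite window_nabla ?leq_addr // nabla_dilate //.
  transitivity (\sum_(i in A) dilate m (fun t =>
      nat_ext (placements 0 1 k (A :\ i) i) (t - (gap 0 1 l i)%:Z)) (v - a%:Z)).
    rewrite /dilate; case: ifP => _; last by rewrite big1.
    exact: nabla_placementsS.
  (* Since [gap a (a + m) l i = a + m * gap 0 1 l i], the shift inside the dilation becomes a shift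
     by the full gap. *)
  apply: eq_bigr => i _; rewrite -dilate_mulB //; congr (dilate _ _ _).
  by rewrite /c /gap; case: ifP => _; lia.
by rewrite iter_window_sum; apply: eq_bigr => i _; rewrite iter_window_shift -IH.
Qed.

End GapDecomposition.

(** * Replacing the divisibility indicator by its mean *)

Lemma size_comp_XsubC_subl (p : {poly rat}) (c : rat) k : (size p <= k.+1)%N ->
  (size (p \Po ('X - c%:P) - p)%R <= k)%N.
Proof.
move=> pk; have sXc := size_XsubC c.
have spc : size (p \Po ('X - c%:P)) = size p by exact: size_comp_poly2.
apply/leq_sizeP => i; rewrite leq_eqVlt => /orP[/eqP <-|ki]; last first.
  by rewrite coefB !nth_default ?subr0 ?spc // (leq_trans pk).
have [pk'|pk'] := leqP (size p) k.
  by rewrite coefB !nth_default ?subr0 ?spc.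
have sp : size p = k.+1 by apply/eqP; rewrite eqn_leq pk.
have : lead_coef (p \Po ('X - c%:P)) = lead_coef p.
  by rewrite lead_coef_comp ?sXc // lead_coefXsubC expr1n mulr1.
by rewrite /lead_coef spc sp coefB /= => ->; rewrite subrr.
Qed.

(* Subtracting p(u) from each p(u - j) leaves polynomials of smaller degree. *)
Lemma iter_window_annihilate a b k (c : int -> rat) (p : {poly rat}) u :
  (forall v, window a b c v = 0) -> (size p <= k)%N ->
  iter k (window a b) (fun v => c v * p.[v%:~R]) u = 0.
Proof.
elim: k c p u => [|k IH] c p u c0 pk.
  by move: pk; rewrite leqn0 size_poly_eq0 => /eqP ->; rewrite /= horner0 mulr0.
pose q (j : nat) := p \Po ('X - (j%:R)%:P) - p.
rewrite iterSr (@eq_iter_window _ _ _ _ (fun v =>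
    \sum_(j <- index_iota a b) c (v - j%:Z) * (q j).[v%:~R])); last first.
  move=> v.
  have sum0 : \sum_(a <= j < b) c (v - j%:Z) * p.[v%:~R] = 0.
    by rewrite -mulr_suml -windowE c0 mul0r.
  rewrite windowE -[LHS]subr0 -[X in _ - X = _]sum0 -sumrB; apply: eq_bigr => j _.
  by rewrite /q hornerD hornerN horner_comp !hornerE mulrBr intrB.
rewrite iter_window_sum big1 // => j _; apply: IH; last first.
  exact: size_comp_XsubC_subl.
move=> v; rewrite -[RHS](c0 (v - j%:Z)) !windowE; apply: eq_bigr => i _.
by rewrite addrAC.
Qed.

Lemma window_dvdz a m u : (0 < m)%N ->
  window a (a + m) (fun v => (m%:Z %| v)%Z%:R) u = 1.
Proof.
move=> m0; rewrite windowE -{1}[a]add0n big_addn addKn big_mkord.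
have mz : m%:Z != 0 by lia.
have rge := modz_ge0 (u - a%:Z) mz; have rlt := ltz_mod (u - a%:Z) mz.
set r := ((u - a%:Z) %% m)%Z in rge rlt.
have rm : (`|r| < m)%N by lia.
have dvdE (j : 'I_m) : (m%:Z %| u - (j + a)%N%:Z)%Z = (j == Ordinal rm).
  rewrite PoszD [_ + a%:Z]addrC opprD addrA -eqz_mod_dvd -/r.
  rewrite [X in _ == X]modz_small; last by rewrite /= ltz_nat ltn_ord.
  by rewrite -val_eqE /= -/r; lia.
rewrite (eq_bigr (fun j => (j == Ordinal rm)%:R)) => [|j _]; last by rewrite dvdE.
by rewrite (bigD1 (Ordinal rm)) //= eqxx big1 ?addr0 // => j /negPf ->.
Qed.

Lemma horner_iter_shift_sum a b k p u :
  (iter k (shift_sum a b) p).[u%:~R] =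
  iter k (window a b) (fun v => p.[v%:~R]) u.
Proof.
have shift j g x : (iter j shift_poly g).[x] = g.[x - j%:R].
  elim: j x => [|j IH] x; first by rewrite subr0.
  rewrite iterS /shift_poly horner_comp IH !hornerE; congr (g.[_]).
  by rewrite -addn1 natrD; ring.
elim: k u => //= k IH u; rewrite windowE /shift_sum horner_sum.
by apply: eq_bigr => j _; rewrite shift -IH intrB.
Qed.

Lemma poly_eq_nat (p r : {poly rat}) Q :
  (forall q, (Q <= q)%N -> p.[q.+1%:R] = r.[q.+1%:R]) -> p = r.
Proof.
move=> pr; apply/eqP; rewrite -subr_eq0; apply: contraT => d0.
pose rs := [seq (Q + i).+1%:R : rat | i <- iota 0 (size (p - r)%R)].
have : (size rs < size (p - r)%R)%N.
  apply: max_poly_roots d0 _ _.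
    apply/allP => _ /mapP[i _ ->].
    by rewrite /root !hornerE pr ?leq_addr // subrr.
  rewrite map_inj_uniq ?iota_uniq // => i j /eqP.
  by rewrite eqr_nat eqSS eqn_add2l => /eqP.
by rewrite size_map size_iota ltnn.
Qed.

Lemma iter_window_dilate_exp a m k u : (0 < m)%N ->
  iter k.+1 (window a (a + m))
    (fun v => (m%:Z %| v)%Z%:R * (v%:~R / m%:R) ^+ k) u =
  m%:R ^- k.+1 * iter k.+1 (window a (a + m)) (fun v => v%:~R ^+ k) u.
Proof.
move=> m0; have mz : m%:R != 0 :> rat by rewrite pnatr_eq0 -lt0n.
(* [c] is the indicator minus its mean, so its window sums vanish; the polynomial v^k / m^k has size
   k + 1 and is killed by k + 1 windows. *)
pose c v : rat := (m%:Z %| v)%Z%:R - m%:R^-1.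
have c0 v : window a (a + m) c v = 0.
  rewrite windowE sumrB; have := window_dvdz a v m0; rewrite windowE => ->.
  rewrite sumr_const_nat addKn.
  by rewrite -[X in _ - X]mulr_natr mulVf ?subrr.
have sp : (size (m%:R ^- k *: 'X^k : {poly rat}) <= k.+1)%N.
  by rewrite (leq_trans (size_scale_leq _ _)) // size_polyXn.
have := iter_window_annihilate u c0 sp.
rewrite (@eq_iter_window _ _ _ _ (fun v =>
    (m%:Z %| v)%Z%:R * (v%:~R / m%:R) ^+ k - m%:R ^- k.+1 * v%:~R ^+ k)).
  by rewrite iter_windowB iter_windowZ => /eqP; rewrite subr_eq0 => /eqP.
move=> v; rewrite /c hornerZ hornerXn mulrBl exprMn exprVn exprS invfM.
by congr (_ - _); ring.
Qed.

(** * Flats and residues *)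

Local Open Scope classical_set_scope.

Lemma flat_le_refl (R : realType) (V : vectType R) : reflexive (@flat_le R V).
Proof. by move=> z; apply/asboolP. Qed.

Lemma flat_le_anti (R : realType) (V : vectType R) :
  antisymmetric (@flat_le R V).
Proof.
by move=> z w /andP[/asboolP wz /asboolP zw]; apply/seteqP; split.
Qed.

Lemma flat_le_trans (R : realType) (V : vectType R) : transitive (@flat_le R V).
Proof.
move=> z y w /asboolP zy /asboolP wz.
by apply/asboolP; exact: subset_trans wz zy.
Qed.

(** The flats through [p] form the interval from V to [zp], the intersection of all members of [A]
    through [p]. Moebius values over an interval sum to 0 unless it is a single element, and as V is
    not in [A], [zp = V] exactly when [p] avoids every member. *)
Lemma sum_mobius_point (R : realType) (V : vectType R) (A : set (set V))
    (p : V) : finite_set A -> ~ A setT ->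
  \sum_(z <- fset_set (flats A) | `[< z p >])
     mobius (fset_set (flats A)) (@flat_le R V) setT z =
  (`[< forall H, A H -> ~ H p >] : nat)%:Z.
Proof.
move=> finA AT; set P := fset_set _.
have inP z : (z \in P) = `[< flats A z >].
  by rewrite in_fset_set ?inE //; exact: finite_flats.
pose zp := \bigcap_(H in [set H | A H /\ H p]) H.
have zpp : zp p by move=> H [].
have zpP : zp \in P.
  rewrite inP; apply/asboolP; split; first by exists p.
  by exists [set H | A H /\ H p] => // H [].
have zpE z : z \in P -> `[< z p >] = flat_le z zp.
  rewrite inP => /asboolP[_ [B BA ->]]; apply/asboolP/asboolP => [Bp|]; last exact.
  by move=> x zx H BH; apply: zx; split; [exact: BA|exact: Bp].
have TP : setT \in P.
  rewrite inP; apply/asboolP; split; first by exists p.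
  by exists set0; rewrite ?bigcap_set0.
have TE z : flat_le setT z by apply/asboolP.
rewrite big_seq_cond (eq_bigl (fun z => (z \in P) && flat_le z zp)); last first.
  by move=> z; apply: andb_id2l => /zpE.
rewrite -big_seq_cond (bigID (pred1 zp)) /= (eq_bigl (pred1 zp)); last first.
  by move=> z /=; case: eqP => [->|]; rewrite ?andbF // andbT; exact: flat_le_refl.
rewrite -big_filter filter_pred1_uniq ?fset_uniq // big_seq1.
have [avoid|] := asboolP.
  have -> : zp = setT.
    by apply/seteqP; split => // x _ H [AH Hp]; case: (avoid H).
  rewrite mobius_diag // big_pred0 ?addr0 // => z.
  apply/negP => /andP[zT /negP]; apply; apply/eqP/flat_le_anti.
  by rewrite zT TE.
move=> /existsNP[H /not_implyP[AH /contrapT Hp]].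
have zpT : setT != zp.
  apply/eqP => zpT; apply: AT; suff <- : H = setT by [].
  by apply/seteqP; split => // x _; have : zp x by [rewrite -zpT|]; exact.
rewrite (mobius_lt (@flat_le_refl _ _) (@flat_le_anti _ _) (@flat_le_trans _ _)) //.
rewrite addrC (eq_bigl (fun z => [&& flat_le setT z, flat_le z zp & z != zp])) ?subrr //.
by move=> z; rewrite TE.
Qed.

(** * Points of V given by arbitrary rows *)

Section Point.
Variables (R : realType) (N : nat).
Local Notation V := (subvs_of (sum_zero R N.+1)).

(** This is the projection along the all-ones vector; it preserves coordinate differences, the only
    data the hyperplanes see. *)
Definition center (y : 'rV[R]_N.+1) : 'rV[R]_N.+1 :=
  \row_i (y 0 i - (\sum_j y 0 j) / N.+1%:R).

Lemma center_sum_zero y : center y \in sum_zero R N.+1.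
Proof.
rewrite mem_sum_zero; under eq_bigr do rewrite mxE.
rewrite sumrB sumr_const card_ord -[X in _ - X]mulr_natr divfK ?subrr //.
by rewrite pnatr_eq0.
Qed.

Definition point (y : 'rV[R]_N.+1) : V := vsproj (sum_zero R N.+1) (center y).

Lemma pcoord_point y i :
  pcoord (point y) i = y 0 i - (\sum_j y 0 j) / N.+1%:R.
Proof. by rewrite /pcoord vsprojK ?center_sum_zero // mxE. Qed.

Lemma pcoord_pointB y i j :
  pcoord (point y) i - pcoord (point y) j = y 0 i - y 0 j.
Proof. by rewrite !pcoord_point; ring. Qed.

Lemma sum_pcoord (x : V) : \sum_i pcoord x i = 0.
Proof. by apply/eqP; rewrite -mem_sum_zero subvsP. Qed.

Lemma pcoord_inj (x x' : V) :
  (forall i, pcoord x i = pcoord x' i) -> x = x'.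
Proof. by move=> e; apply/val_inj/rowP => i; exact: e. Qed.

Lemma pcoordB (x x' : V) i : pcoord (x - x') i = pcoord x i - pcoord x' i.
Proof. by rewrite /pcoord linearB !mxE. Qed.

Lemma point_pcoordB (x : V) l : point (\row_i (pcoord x i - pcoord x l)) = x.
Proof.
apply: pcoord_inj => i; rewrite pcoord_point mxE.
under eq_bigr do rewrite mxE; rewrite sumrB sum_pcoord sumr_const card_ord.
by rewrite sub0r mulNr -[X in - - (X / _)]mulr_natr mulfK ?pnatr_eq0 // opprK subrK.
Qed.

Lemma point_is_linear : linear point.
Proof.
move=> k u v; rewrite /point -linearP; congr (vsproj _ _).
apply/rowP => i; rewrite !mxE; under eq_bigr do rewrite !mxE.
by rewrite big_split -mulr_sumr /=; ring.
Qed.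

HB.instance Definition _ :=
  GRing.isLinear.Build R 'rV[R]_N.+1 V _ point point_is_linear.

End Point.

(** * Dimension and residue count of a flat *)

Section FlatStructure.
Variables (R : realType) (N : nat).
Local Notation V := (subvs_of (sum_zero R N.+1)).

Definition free_coords (rep : 'I_N.+1 -> 'I_N.+1) : pred 'I_N.+1 :=
  [pred i | (rep i == i) && (i != ord_max)].

(* [rep] picks one coordinate in each block of coordinates whose differences
   are constant on the flat; the block of the last coordinate is represented
   by [ord_max], so that the other representatives are free. *)
Lemma flat_normal_form a b (z : set V) : flats (trunc_arr a b) z ->
  exists (rep : 'I_N.+1 -> 'I_N.+1) (d : 'I_N.+1 -> int),
  [/\ forall i, rep (rep i) = rep i, rep ord_max = ord_max,
      forall i, d (rep i) = 0,
      z = [set x | forall i, pcoord x i - pcoord x (rep i) = (d i)%:~R] &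
      forall x, (forall (i j : 'I_N.+1) (k : int), (i < j)%N ->
          - a%:Z + 1 <= k <= b%:Z - 1 -> rep i = rep j -> d i - d j = k ->
          pcoord x i - pcoord x j = k%:~R) -> z x].
Proof.
move=> [[x0 zx0] [B BA zE]].
pose cst i j (k : int) := forall x, z x -> pcoord x i - pcoord x j = k%:~R.
pose e i j := `[< exists k, cst i j k >].
have e_refl i : e i i by apply/asboolP; exists 0 => x _; rewrite subrr.
have e_sym i j : e i j -> e j i.
  move=> /asboolP[k ck]; apply/asboolP; exists (- k) => x /ck.
  by rewrite mulrNz => <-; rewrite opprB.
have e_trans j i k : e i j -> e j k -> e i k.
  move=> /asboolP[m cm] /asboolP[m' cm']; apply/asboolP; exists (m + m') => x zx.
  by rewrite intrD -(cm x) // -(cm' x) // addrA subrK.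
have e_eq i j : e i j -> e i =1 e j.
  move=> ij k; apply/idP/idP; last exact: e_trans.
  by apply: e_trans; exact: e_sym.
(* [pick] depends only on the predicate [e i], so it gives one value per block; by reflexivity the
   default [i] is never reached. *)
pose rep i := if e i ord_max then ord_max else odflt i [pick j | e i j].
have e_rep i : e i (rep i).
  rewrite /rep; case: ifP => // _.
  by case: pickP => //= /(_ i); rewrite e_refl.
have rep_eq i j : e i j -> rep i = rep j.
  move=> ij; rewrite /rep (e_eq _ _ ij) (eq_pick (e_eq _ _ ij)).
  by case: ifP => // _; case: pickP => //= /(_ j); rewrite e_refl.
have [d dP] : {d : 'I_N.+1 -> int & forall i, cst i (rep i) (d i)}.
  by apply: (boolp.choice (P := fun i => cst i (rep i))) => i; apply/asboolP/e_rep.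
have repK i : rep (rep i) = rep i by apply/esym/rep_eq.
have dB i j k : cst i j k -> rep i = rep j /\ d i - d j = k.
  move=> ck; have rij : rep i = rep j by apply: rep_eq; apply/asboolP; exists k.
  split=> //; apply: (@intr_inj R); rewrite intrB -(dP i x0) // -(dP j x0) //.
  by rewrite -(ck x0) // rij opprB addrA subrK.
(* A hyperplane in [B] contains z, so its equation is one of the constant differences; hence those
   with [k] in the range of the arrangement already define z. *)
have suffB x : (forall (i j : 'I_N.+1) (k : int), (i < j)%N ->
    - a%:Z + 1 <= k <= b%:Z - 1 -> rep i = rep j -> d i - d j = k ->
    pcoord x i - pcoord x j = k%:~R) -> z x.
  move=> h; rewrite zE => H BH; have [i [j [k [ij kab HE]]]] := BA _ BH.
  have ck : cst i j k by move=> y; rewrite zE => /(_ _ BH); rewrite HE.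
  by rewrite HE; have [rij dij] := dB _ _ _ ck; exact: h.
exists rep, d; split => //.
- by rewrite /rep e_refl.
- move=> i; apply: (@intr_inj R).
  by rewrite -(dP (rep i) x0) // repK subrr.
apply/seteqP; split => [x zx i|x /= h]; first exact: dP.
apply: suffB => i j k _ _ rij <-.
by rewrite intrB -!h rij opprB addrA subrK.
Qed.

Lemma affine_dim_normal_form (rep : 'I_N.+1 -> 'I_N.+1) (d : 'I_N.+1 -> int) :
  (forall i, rep (rep i) = rep i) -> rep ord_max = ord_max ->
  (forall i, d (rep i) = 0) ->
  affine_dim [set x : V | forall i, pcoord x i - pcoord x (rep i) = (d i)%:~R] =
  #|free_coords rep|.
Proof.
move=> repK rep_max d0; set Q := free_coords rep.
(* [M] copies each free value to its whole block and puts 0 on the block of [ord_max]. *)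
pose M : 'M[R]_(#|Q|, N.+1) := \matrix_(k, i) (enum_val k == rep i)%:R.
have MQ (w : 'rV_#|Q|) k : (w *m M) 0 (enum_val k) = w 0 k.
  have /andP[/eqP rk _] := enum_valP k.
  rewrite mxE (bigD1 k) //= mxE rk eqxx mulr1 big1 ?addr0 // => l lk.
  by rewrite mxE rk (inj_eq enum_val_inj) (negPf lk) mulr0.
have Mmax (w : 'rV_#|Q|) : (w *m M) 0 ord_max = 0.
  rewrite mxE big1 // => l _; rewrite mxE rep_max.
  by have /andP[_ /negPf ->] := enum_valP l; rewrite mulr0.
have Mrep (w : 'rV_#|Q|) i : (w *m M) 0 (rep i) = (w *m M) 0 i.
  by rewrite !mxE; apply: eq_bigr => l _; rewrite !mxE repK.
pose phi : 'Hom('rV[R]_#|Q|, V) := linfun (@point R N \o mulmxr M).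
have phiE w : phi w = point (w *m M) by rewrite lfunE.
have ker_phi : lker phi == 0%VS.
  apply/lker0P => w w'; rewrite !phiE => ww'; apply/rowP => k.
  rewrite -!MQ; have := pcoord_pointB (w *m M) (enum_val k) ord_max.
  by rewrite ww' pcoord_pointB !Mmax !subr0.
have img (u : V) : (u \in limg phi) <-> forall i, pcoord u i = pcoord u (rep i).
  split=> [/memv_imgP[w _ ->] i|h].
    by apply/eqP; rewrite -subr_eq0 phiE pcoord_pointB Mrep subrr.
  apply/memv_imgP; exists (\row_k (pcoord u (enum_val k) - pcoord u ord_max)).
    exact: memvf.
  rewrite phiE -[LHS](point_pcoordB u ord_max); congr point; apply/rowP => i.
  rewrite -Mrep [LHS]mxE h.
  have [/eqP ri|ri] := boolP (rep i == ord_max).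
    by rewrite ri Mmax subrr.
  have riQ : rep i \in Q by rewrite inE repK eqxx.
  by rewrite -(enum_rankK_in riQ riQ) MQ mxE.
(* [d] is itself a particular solution because it vanishes at representatives. *)
pose D : 'rV[R]_N.+1 := \row_i (d i)%:~R.
have DE i : pcoord (point D) i - pcoord (point D) (rep i) = (d i)%:~R.
  by rewrite pcoord_pointB !mxE d0 subr0.
have -> : [set x : V | forall i, pcoord x i - pcoord x (rep i) = (d i)%:~R] =
    [set x | x - point D \in limg phi].
  apply/seteqP; split => x /=; rewrite img => h i.
    by rewrite !pcoordB; have := h i; have := DE i; lra.
  by have := h i; rewrite !pcoordB; have := DE i; lra.
have full0 : (fullv :&: lker phi = 0)%VS by rewrite (eqP ker_phi) capv0.
by rewrite affine_dimE (limg_dim_eq full0) dimvf /dim /= mul1n.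
Qed.

(** The values at free representatives are arbitrary; the congruences and the zero at [ord_max] then
    determine all the others. *)
Lemma card_normal_form q (rep : 'I_N.+1 -> 'I_N.+1) (d : 'I_N.+1 -> int) :
  (forall i, rep (rep i) = rep i) -> rep ord_max = ord_max ->
  (forall i, d (rep i) = 0) ->
  #|[pred e : {ffun 'I_N.+1 -> 'I_q.+1} | (e ord_max == ord0) &&
     [forall i, (q.+1%:Z %| (e (rep i))%:Z - (e i)%:Z - d i)%Z]]| =
  (q.+1 ^ #|free_coords rep|)%N.
Proof.
move=> repK rep_max d0; set Q := free_coords rep.
rewrite -[q.+1 in RHS]card_ord -(card_pffun_on ord0 Q predT).
pose F (f : {ffun 'I_N.+1 -> 'I_q.+1}) : {ffun 'I_N.+1 -> 'I_q.+1} :=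
  [ffun i => inord `|(((f (rep i))%:Z - d i) %% q.+1)%Z|%N].
have FE f i : (F f i)%:Z = (((f (rep i))%:Z - d i) %% q.+1)%Z.
  have ge0 : 0 <= (((f (rep i))%:Z - d i) %% q.+1)%Z by exact: modz_ge0.
  have lt := ltz_mod ((f (rep i))%:Z - d i) (isT : q.+1%:Z != 0).
  rewrite ffunE inordK; first by rewrite gez0_abs.
  by rewrite -ltz_nat gez0_abs.
have Frep f i : F f (rep i) = f (rep i).
  by apply/val_inj/eqP; rewrite -eqz_nat FE repK d0 subr0 modz_small //= ltz_nat.
rewrite -[in RHS](card_in_imset (f := F)); last first.
  move=> f g /pffun_onP[/supportP fQ _] /pffun_onP[/supportP gQ _] fg.
  apply/ffunP => i; have [/andP[/eqP <- _]|iQ] := boolP (i \in Q).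
    by rewrite -(Frep f) fg Frep.
  by rewrite fQ // gQ.
apply: eq_card => e; rewrite !inE; apply/andP/imsetP => [[/eqP e_max /forallP he]|].
  exists [ffun i => if i \in Q then e i else ord0].
    apply/(pffun_onP (y := ord0)); split=> [|y _]; last by rewrite inE.
    by apply/supportP => i iQ; rewrite ffunE (negPf iQ).
  apply/ffunP => i; apply/val_inj/eqP; rewrite -eqz_nat FE ffunE.
  have -> : (if rep i \in Q then e (rep i) else ord0) = e (rep i).
    by rewrite unfold_in /= repK eqxx /=; case: eqP => // ->; rewrite e_max.
  rewrite -[X in X == _](@modz_small _ q.+1%:Z) /= ?ltz_nat //.
  by rewrite eq_sym eqz_mod_dvd addrAC.
move=> [f /pffun_onP[/supportP fQ _] ->]; split.
  by rewrite -rep_max Frep rep_max fQ // inE eqxx andbF.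
apply/forallP => i; rewrite Frep FE addrAC -eqz_mod_dvd.
by rewrite modz_mod.
Qed.

End FlatStructure.

Lemma dvdz_lt_eq0 (d x : int) : `|x| < d -> (d %| x)%Z -> x = 0.
Proof.
move=> xd /dvdzP[t tE]; rewrite tE normrM in xd.
have d0 : 0 < d by apply: le_lt_trans xd; rewrite mulr_ge0.
rewrite (gtr0_norm d0) gtr_pMl // in xd.
have t0 : t = 0 by lia.
by rewrite tE t0 mul0r.
Qed.

(* Cutting the circle Z/q inside a gap of length b between consecutive points
   turns congruences modulo q into equalities of integers. *)
Lemma lift_cyclic n b q (e : {ffun 'I_n -> 'I_q.+1}) : (n * b < q.+1)%N ->
  exists Y : 'I_n -> int,
    (forall i j, `|Y i - Y j| + b%:Z < q.+1%:Z) /\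
    (forall i j, (q.+1%:Z %| (Y i - Y j) - ((e j)%:Z - (e i)%:Z))%Z).
Proof.
move=> nbq.
(* These are the residues reached from some [e i] in fewer than [b] steps. There are at most [n * b]
   of them, so some [c] is not reached. *)
pose blocked (p : 'I_n * 'I_b) : 'I_q.+1 := inord ((e p.1 + p.2) %% q.+1).
have [c cfree] : exists c, c \notin codom blocked.
  apply/existsP; rewrite -negb_forall; apply: contraL nbq => /forallP call.
  rewrite -leqNgt; apply: (@leq_trans #|codom blocked|).
    rewrite -[q.+1 in X in (X <= _)%N]card_ord; apply: subset_leq_card.
    by apply/fintype.subsetP => x _; exact: call.
  by rewrite (leq_trans (leq_image_card _ _)) // card_prod !card_ord.
(* The forward distances to [c] lie between [b] and [q], so any two differ by at most [q - b]. *)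
exists (fun i => ((c%:Z - (e i)%:Z) %% q.+1)%Z).
have lo i : b%:Z <= ((c%:Z - (e i)%:Z) %% q.+1)%Z.
  rewrite leNgt; apply: contra cfree => lt.
  have ge0 : 0 <= ((c%:Z - (e i)%:Z) %% q.+1)%Z by exact: modz_ge0.
  have tb : (`|((c%:Z - (e i)%:Z) %% q.+1)%Z| < b)%N.
    by rewrite -ltz_nat gez0_abs.
  apply/codomP; exists (i, Ordinal tb); apply/val_inj; rewrite /= inordK ?ltn_pmod //.
  apply/eqP; rewrite -eqz_nat -modz_nat PoszD gez0_abs // modzDmr.
  by rewrite /= addrC subrK modz_small ?eqxx //= ltz_nat.
have hi i : ((c%:Z - (e i)%:Z) %% q.+1)%Z < q.+1%:Z by exact: ltz_pmod.
split=> i j; first by have := lo i; have := lo j; have := hi i; have := hi j; lia.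
have -> : (e j)%:Z - (e i)%:Z = (c%:Z - (e i)%:Z) - (c%:Z - (e j)%:Z) by lia.
by rewrite -eqz_mod_dvd -modzDm -modzNm !modz_mod modzNm modzDm.
Qed.

(** * The characteristic polynomial as a count of residue vectors *)

Section PointCount.
Variables (R : realType) (N a b : nat).
Local Notation V := (subvs_of (sum_zero R N.+1)).

Definition residue_avoids q (e : {ffun 'I_N.+1 -> 'I_q.+1}) : Prop :=
  forall (i j : 'I_N.+1) (k : int), (i < j)%N -> - a%:Z + 1 <= k <= b%:Z - 1 ->
    ~~ (q.+1%:Z %| (e j)%:Z - (e i)%:Z - k)%Z.

Lemma trunc_arr_setT : ~ @trunc_arr R N.+1 a b setT.
Proof.
move=> [i [j [k [ij _ /seteqP[sub _]]]]].
have := sub (point (\row_l (if l == i then k + 1 else 0)%:~R)) I.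
have ji : (j == i) = false by rewrite -val_eqE gtn_eqF.
by rewrite /= pcoord_pointB !mxE eqxx ji subr0 => /intr_inj; lia.
Qed.

(* Finite field method, for an arbitrary large modulus: the residues modulo q
   are normalized by making the last coordinate vanish, as V has dimension N. *)
Lemma charpoly_count q : (a < b)%N -> (N.+1 * b < q.+1)%N ->
  (arr_charpoly (@trunc_arr R N.+1 a b)).[q.+1%:R] =
  #|[pred e : {ffun 'I_N.+1 -> 'I_q.+1} |
      (e ord_max == ord0) && `[< residue_avoids e >]]|%:R.
Proof.
move=> ab nbq; set A := trunc_arr a b; set P := fset_set (flats A).
have dvd_eq m n : (q.+1%:Z %| m)%Z -> m = n -> (q.+1%:Z %| n)%Z by move=> + <-.
have finA : finite_set A by exact: finite_trunc_arr.
have [Y YP] := boolp.choice (fun e => @lift_cyclic N.+1 b q e nbq).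
pose p e : V := point (\row_i (Y e i)%:~R).
have pB e i j (k : int) :
    pcoord (p e) i - pcoord (p e) j = k%:~R <-> Y e i - Y e j = k.
  by rewrite pcoord_pointB !mxE -intrB; split=> [/intr_inj|->].
(* From [a < b] one gets [|k| < b], so [Y e i - Y e j - k] is smaller than the modulus in absolute
   value and divisibility forces it to be 0. *)
have pH e i j (k : int) : - a%:Z + 1 <= k <= b%:Z - 1 ->
    pcoord (p e) i - pcoord (p e) j = k%:~R <->
    (q.+1%:Z %| (e j)%:Z - (e i)%:Z - k)%Z.
  move=> kab; rewrite pB; have [/(_ i j) Yb /(_ i j) Yq] := YP e.
  have -> : (q.+1%:Z %| (e j)%:Z - (e i)%:Z - k)%Z =
      (q.+1%:Z %| Y e i - Y e j - k)%Z.
    by apply/idP/idP => h; [apply: dvd_eq (rpredD h Yq) _|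
      apply: dvd_eq (rpredB h Yq) _]; lia.
  split=> [<-|]; first by rewrite subrr dvdz0.
  by move=> /dvdz_lt_eq0; lia.
have count z : z \in P ->
    \sum_(e : {ffun 'I_N.+1 -> 'I_q.+1} | e ord_max == ord0) (`[< z (p e) >] : nat)
    = (q.+1 ^ affine_dim z)%N.
  rewrite in_fset_set ?inE; last exact: finite_flats.
  move=> /flat_normal_form[rep [d [repK rep_max d0 zE suffB]]].
  rewrite [in RHS]zE affine_dim_normal_form // -(card_normal_form _ repK rep_max d0).
  rewrite -sum1_card big_mkcondr /=; apply: eq_bigr => e _.
  have [_ Yq] := YP e.
  have -> : `[< z (p e) >] =
      [forall i, (q.+1%:Z %| (e (rep i))%:Z - (e i)%:Z - d i)%Z].
    apply/asboolP/forallP => [zp i|h]; last first.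
      (* The numbers [d i] may be large; only equations with constants in the range of the
         arrangement lift from congruences. *)
      apply: suffB => i j k ij kab rij dij; apply/pH => //.
      by apply: dvd_eq (rpredB (h i) (h j)) _; rewrite rij; lia.
    have /pB <- : pcoord (p e) i - pcoord (p e) (rep i) = (d i)%:~R.
      by move: zp; rewrite zE; exact.
    by rewrite -rpredN; apply: dvd_eq (Yq i (rep i)) _; lia.
  by case: ifP.
have -> : #|[pred e : {ffun 'I_N.+1 -> 'I_q.+1} |
      (e ord_max == ord0) && `[< residue_avoids e >]]| =
    \sum_(e : {ffun 'I_N.+1 -> 'I_q.+1} | e ord_max == ord0)
      (`[< forall H, A H -> ~ H (p e) >] : nat).
  rewrite -sum1_card big_mkcondr /=; apply: eq_bigr => e _.
  suff -> : `[< residue_avoids e >] = `[< forall H, A H -> ~ H (p e) >].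
    by case: ifP.
  apply: asbool_equiv_eq; split=> h.
    move=> H [i [j [k [ij kab ->]]]] /= /pH => /(_ kab).
    by apply/negP; exact: h.
  move=> i j k ij kab; apply/negP => /pH => /(_ kab).
  by apply: (h [set x | pcoord x i - pcoord x j = k%:~R]); exists i, j, k.
(* Each power of the modulus is written as a count of points; exchanging the sums leaves, for each
   [e], the Moebius sum over the flats through [p e]. *)
rewrite natr_sum /arr_charpoly horner_sum big_seq.
under eq_bigr => z zP.
  rewrite hornerZ hornerXn -natrX -(count z zP) natr_sum mulr_sumr.
  over.
rewrite -big_seq exchange_big /=; apply: eq_bigr => e _.
have := congr1 (fun m : int => m%:~R : rat)
  (sum_mobius_point (p e) finA trunc_arr_setT).
rewrite rmorph_sum /= big_mkcond /= -pmulrn => <-.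
by apply: eq_bigr => z _; case: ifP; rewrite ?mulr1 ?mulr0.
Qed.

End PointCount.

(** The label [ord_max] at residue 0 is both the start and the end of a segment of length [q.+1].
    Pairs containing it give the bounds at the two ends, and other pairs give the conditions between
    labels. *)
Lemma card_residue_avoids N a b q : (a < b)%N -> (N.+1 * b < q.+1)%N ->
  #|[pred e : {ffun 'I_N.+1 -> 'I_q.+1} |
      (e ord_max == ord0) && `[< residue_avoids a b e >]]| =
  placements a b N [set~ ord_max]%SET (ord_max : 'I_N.+1) q.+1.
Proof.
move=> ab nbq; set A := [set~ ord_max]%SET.
have AP i : (i \in A) = (i != ord_max) by rewrite !inE.
have Alt i : i \in A -> (i < N)%N.
  by rewrite AP -val_eqE /=; have := ltn_ord i; lia.
have cA : #|A| = N by rewrite cardsC1 card_ord.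
have gapA i : gap a b ord_max i = b by rewrite /gap ltnNge -ltnS ltn_ord.
have -> : placements a b N A = placements a b #|A| A by rewrite cA.
rewrite -(@card_placement _ _ _ ab q); last by move=> i _; rewrite gapA; lia.
have bq : (2 * b < q.+1)%N \/ N = 0 by nia.
apply: eq_card => e; apply/andP/placementP => [[/eqP e0 /asboolP avoid]|].
  have dvd_eq0 (x : int) : x = 0 -> (q.+1%:Z %| x)%Z by move=> ->; exact: dvdz0.
  split; first by move=> i; rewrite AP negbK => /eqP ->.
  - by nia.
  - move=> i iA; have := avoid i ord_max _ (Alt i iA); rewrite e0 gapA /=.
    move: (nat_of_ord (e i)) (ltn_ord (e i)) => x xq {}avoid.
    (* The forbidden constants are [- x] if [x < a], and [q.+1 - x] if the distance from the start
       is below [b]. *)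
    split; rewrite leqNgt; apply/negP => lt.
      have /negP := avoid (- x%:Z) ltac:(lia); apply.
      by apply: dvd_eq0; lia.
    have /negP := avoid (q.+1%:Z - x%:Z) ltac:(lia); apply.
    have -> : 0%:Z - x%:Z - (q.+1%:Z - x%:Z) = - q.+1%:Z by lia.
    by rewrite rpredN dvdzz.
  - move=> i j iA jA ij; have := avoid i j _ ij.
    move: (nat_of_ord (e i)) (nat_of_ord (e j)) => x y {}avoid.
    case: (leqP (x + b) y) => [|le1]; first by left.
    case: (leqP (y + a) x) => [|le2]; first by right.
    have /negP := avoid (y%:Z - x%:Z) ltac:(lia).
    by case; rewrite subrr dvdz0.
move=> [h1 _ h3 h4]; have e0 : e ord_max = ord0 by apply: h1; rewrite AP eqxx.
split; first by rewrite e0.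
(* The bounds at the two ends keep [e j - e i - k] below the modulus in absolute value, so no
   congruence wraps around. *)
apply/asboolP => i j k ij kab; apply/negP => dvd.
have iA : i \in A by rewrite AP -val_eqE /=; have := ltn_ord j; lia.
have := h3 i iA; rewrite gapA => - [ai ib].
have [jA|] := boolP (j \in A); last first.
  rewrite AP negbK => /eqP jmax; move: dvd; rewrite jmax e0 => /dvdz_lt_eq0 /=.
  by move: (nat_of_ord (e i)) ai ib => x ai ib; lia.
have := h3 j jA; rewrite gapA => - [aj jb].
have := h4 i j iA jA ij; move: dvd => /dvdz_lt_eq0.
move: (nat_of_ord (e i)) (nat_of_ord (e j)) ai ib aj jb => x y; lia.
Qed.

Theorem theorem9p7 (R : realType) (a b n : nat) (hab : (a < b)%N) (hn : (1 <= n)%N) :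
  arr_charpoly (@trunc_arr R n a b) =
  (b%:R - a%:R) ^- n *: iter n (shift_sum a b) 'X^(n - 1).
Proof.
case: n hn => // N _; rewrite subn1 /=.
apply: (@poly_eq_nat _ _ (N.+1 * b)) => q nbq.
rewrite charpoly_count // card_residue_avoids // hornerZ -natrB ?(ltnW hab) //.
have [m m0 bE] : exists2 m, (0 < m)%N & b = (a + m)%N.
  by exists (b - a)%N; [rewrite subn_gt0|rewrite subnKC // ltnW].
have := horner_iter_shift_sum a b N.+1 'X^N q.+1%:Z; rewrite -pmulrn => ->.
rewrite (@eq_iter_window _ _ _ _ (fun v => v%:~R ^+ N)); last first.
  by move=> v; rewrite hornerXn.
rewrite bE addKn -iter_window_dilate_exp //.
set A := [set~ ord_max]%SET.
have cA : #|A| = N by rewrite cardsC1 card_ord.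
rewrite -[LHS]/(nat_ext (placements a (a + m) N A ord_max) q.+1%:Z).
(* The dilated count and the polynomial expression need to be compared only at nonnegative
   arguments, as [q] is large enough for the windows to stay there. *)
rewrite placements_dilate //; apply: eq_iter_window_ge0 => [u u0|]; last first.
  by rewrite -bE lez_nat ltnW // ltnS.
rewrite /dilate; case: ifP => [/dvdzP[t tE]|_]; last by rewrite mul0r.
have t0 : 0 <= t by move: u0; rewrite tE pmulr_lge0.
rewrite tE mulzK; last by lia.
have Alt i : i \in A -> (i < (ord_max : 'I_N.+1))%N.
  by rewrite !inE -val_eqE /=; have := ltn_ord i; lia.
case: t t0 {tE} => // t _; have := placements01 t Alt; rewrite cA /= => ->.
rewrite natrX mul1r intrM mulfK // pnatr_eq0; lia.
Qed.
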